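(* Let $K$ be a field (of arbitrary characteristic), let $R$ be a polynomial ring over $K$ in $n$ variables with a fixed monomial order, and let $d$ be a non-negative integer. Let $\mathcal G\subset R$ be a homogeneous Gröbner basis up to degree $d$ of the ideal $\langle \mathcal G\rangle$. Let $p\in R$ be a homogeneous polynomial of degree $d$ with $p\notin\langle\mathcal G\rangle$. Then $\mathcal G\cup\{\mathrm{rem}(p;\mathcal G)\}$ is a homogeneous Gröbner basis up to degree $d$ of the ideal $\langle \mathcal G\cup\{p\}\rangle$.
   Context: Degrees are the standard total degrees on $R$, and the monomial order is a well-ordering on monomials compatible with multiplication. For a subset $A\subset R$, $\langle A\rangle$ is the ideal of $R$ generated by $A$. For nonzero $p\in R$, $lm(p)$ is the leading monomial, $lc(p)$ its coefficient in $p$, and $lt(p)=lc(p)\,lm(p)$ the leading term. The $S$-polynomial of nonzero $p,q\in R$ is $$S(p,q)=\frac{LCM(lm(p),lm(q))}{lt(p)}\,p-\frac{LCM(lm(p),lm(q))}{lt(q)}\,q .$$ For $p\in R$ and a finite list $g_1,\dots,g_k$ of nonzero polynomials, $\mathrm{rem}(p;g_1,\dots,g_k)$ denotes the remainder of $p$ under multivariate division (reduction) by $g_1,\dots,g_k$: one repeatedly subtracts term multiples of the $g_i$ to cancel terms divisible by some $lm(g_i)$, until no monomial of the result is divisible by any $lm(g_i)$. In general the remainder depends on the order in which the $g_i$ are listed; for a finite set $\mathcal G$, $\mathrm{rem}(p;\mathcal G)$ is the remainder with respect to a chosen listing of its elements. A finite set $\{g_1,\dots,g_k\}\subset R$ of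 (nonzero) homogeneous polynomials is called a homogeneous Gröbner basis up to degree $d$ of the ideal $\langle g_1,\dots,g_k\rangle$ if, for all $i,j=1,\dots,k$, either $\mathrm{rem}(S(g_i,g_j);g_1,\dots,g_k)=0$ or $\deg(S(g_i,g_j))>d$. In particular, saying that a set is a homogeneous Gröbner basis up to degree $d$ of an ideal $I$ includes that the set generates $I$. *)

(* Defs.v *)
From HB Require Import structures.
From mathcomp Require Import all_boot all_order all_algebra.
From mathcomp Require Import finmap.
From mathcomp Require Import mpoly.

Set Implicit Arguments.
Unset Strict Implicit.
Unset Printing Implicit Defensive.

Import GRing.Theory.
Local Open Scope ring_scope.

(* The order carried by 'X_{1..n} in the library is the fixed order degrevlex
   (and (m1 <= m2)%MM is divisibility), so an arbitrary monomial order needs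
   its own record. *)
Record monomial_order (n : nat) := MonomialOrder {
  mo_le :> rel 'X_{1..n};
  mo_refl : reflexive mo_le;
  mo_anti : antisymmetric mo_le;
  mo_trans : transitive mo_le;
  mo_total : total mo_le;
  mo_mul : forall m m1 m2, mo_le m1 m2 -> mo_le (m + m1)%MM (m + m2)%MM;
  mo_wf : well_founded (fun m1 m2 => mo_le m1 m2 && (m1 != m2))
}.

Section Division.
Variables (K : fieldType) (n : nat) (ord : monomial_order n).
Local Notation R := {mpoly K[n]}.
Implicit Types (p q g : R) (gs : seq R).

(* Total degree, with value 0 at the zero polynomial. *)
Definition tdeg p : nat := (msize p).-1.

(* The largest monomial of the support; junk value 0%MM at p = 0. *)
Definition lm p : 'X_{1..n} := last 0%MM (sort ord (msupp p)).
Definition lc p : K := p@_(lm p).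
Definition lt p : R := lc p *: 'X_[lm p].

Definition Spoly p q : R :=
  let L := mlcm (lm p) (lm q) in
  (lc p)^-1 *: 'X_[L - lm p] * p - (lc q)^-1 *: 'X_[L - lm q] * q.

(* The first element of gs whose leading monomial divides lm p; zero entries of
   gs are ignored. *)
Definition divisor gs p : option R :=
  ohead [seq g <- gs | (g != 0) && (lm g <= lm p)%MM].

(* One step of the division algorithm on the current dividend p: either the
   leading term of p is cancelled by the first possible g in gs, or it is moved
   to the remainder. *)
Definition div_next gs p : R :=
  if divisor gs p is Some g
  then p - (lc p / lc g) *: 'X_[lm p - lm g] * g
  else p - lt p.
Definition div_out gs p : R := if divisor gs p is Some _ then 0 else lt p.

Definition div_lt q p :=
  p != 0 /\ (q = 0 \/ (ord (lm q) (lm p) && (lm q != lm p))).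

Lemma div_lt_wf : well_founded div_lt.
Proof.
have acc0 : Acc div_lt 0 by constructor=> y [/eqP].
move=> p; move Em : (lm p) => m.
elim: (mo_wf ord m) p Em => {}m _ IH p Em; constructor=> q [_ [-> //|ltqp]].
by apply: (IH (lm q)) => //; rewrite -Em.
Qed.

Lemma lm_in p : p != 0 -> lm p \in msupp p.
Proof.
rewrite -msupp_eq0 -(mem_sort ord) /lm.
rewrite -size_eq0 -(size_sort ord) size_eq0.
by case: (sort _ _) => // a s _; rewrite /= mem_last.
Qed.

Lemma lc_neq0 p : p != 0 -> lc p != 0.
Proof. by move/lm_in; rewrite mcoeff_msupp. Qed.

Lemma lm_max p m : m \in msupp p -> ord m (lm p).
Proof.
rewrite -(mem_sort ord) /lm.
have := sort_sorted (mo_total ord) (msupp p).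
case/lastP: (sort _ _) => // s x; rewrite last_rcons mem_rcons inE.
rewrite -rev_sorted rev_rcons /= (path_sortedE) => [/andP[/allP h _]|].
  case/orP=> [/eqP ->|ms]; first exact: mo_refl.
  by apply: h; rewrite mem_rev.
by move=> y x' z h1 h2; apply: mo_trans h2 h1.
Qed.

Lemma div_lt_sub p h : p != 0 -> h@_(lm p) = lc p ->
  (forall m, m \in msupp h -> ord m (lm p)) -> div_lt (p - h) p.
Proof.
move=> p0 hc hm; split=> //; have [->|q0] := eqVneq (p - h) 0; first by left.
right; have lq := lm_in q0; apply/andP; split.
  by have := msuppB_le lq; rewrite mem_cat => /orP[/lm_max|/hm].
apply: contraTneq lq => ->.
by rewrite mcoeff_msupp mcoeffB hc subrr eqxx.
Qed.

Lemma div_next_lt gs p : p <> 0 -> div_lt (div_next gs p) p.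
Proof.
move/eqP=> p0; rewrite /div_next /divisor.
set s := [seq g <- gs | _]; have: {subset s <= s} by [].
case: {1 3}s => [|g t] /=.
  move=> _; apply: div_lt_sub => // [|m].
    by rewrite mcoeffZ mcoeffX eqxx mulr1.
  move/msuppZ_le; rewrite msuppX inE => /eqP ->; exact: mo_refl.
move/(_ g (mem_head _ _)); rewrite mem_filter => /andP[/andP[g0 dvd] _].
apply: div_lt_sub => // [|m].
  rewrite -scalerAl (mulrC 'X_[_]) mcoeffZ.
  have -> : (g * 'X_[lm p - lm g])@_(lm p) = lc g.
    by rewrite -[X in _@_X = _](submK dvd) mcoeffMX.
  by rewrite mulfVK // lc_neq0.
rewrite -scalerAl => /msuppZ_le; rewrite (mulrC 'X_[_]) (perm_mem (msuppMX _ _)).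
case/mapP=> m' /lm_max hm' ->; rewrite -[X in ord _ X](submK dvd).
exact: mo_mul.
Qed.

Definition mrem p gs : R :=
  Fix div_lt_wf (fun _ => R)
    (fun q rec =>
       if q =P 0 is ReflectF q0
       then div_out gs q + rec (div_next gs q) (div_next_lt gs q0)
       else 0) p.

Lemma mrem_unfold p gs : mrem p gs =
  if p == 0 then 0 else div_out gs p + mrem (div_next gs p) gs.
Proof.
rewrite /mrem Fix_eq; first by case: eqP.
by move=> q f g fg; case: eqP => // q0; rewrite fg.
Qed.

Definition genideal (A : {fset R}) (f : R) : Prop :=
  exists c : R -> R, f = \sum_(g <- A) c g * g.

(* A choice of a listing of the elements of every finite set. *)
Definition is_listing (l : {fset R} -> seq R) : Prop :=
  forall A : {fset R}, uniq (l A) /\ l A =i A.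

(* G is a homogeneous Groebner basis up to degree d of the ideal I, where
   remainders are computed with respect to the chosen listings. *)
Definition homog_groebner_upto (l : {fset R} -> seq R) (d : nat)
    (G : {fset R}) (I : R -> Prop) : Prop :=
  [/\ forall g, g \in G -> g != 0 /\ exists e, g \is e.-homog,
      forall f, I f <-> genideal G f
    & forall g h, g \in G -> h \in G ->
        mrem (Spoly g h) (l G) = 0 \/ (d < tdeg (Spoly g h))%N].

End Division.

(* Main.v *)
Require Import Defs.
From mathcomp Require Import all_boot all_order all_algebra.
From mathcomp Require Import finmap.
From mathcomp Require Import mpoly.

Set Implicit Arguments.
Unset Strict Implicit.
Unset Printing Implicit Defensive.

Import GRing.Theory.
Local Open Scope ring_scope.

(** Everything rests on the criterion of Buchberger, truncated at degree [d]: if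
    the S-polynomials of degree at most [d] of the homogeneous family [G] reduce
    to zero, then the leading monomial of every nonzero homogeneous element of
    degree at most [d] of the ideal of [G] is divisible by the leading monomial
    of an element of [G] ([lm_dvd_of_genideal]).  It is proved by rewriting a
    combination of monomial multiples of generators until its highest term no
    longer cancels: two multiples with the same leading monomial [m] differ by a
    monomial multiple of an S-polynomial ([critical_pair]), which division
    writes with strictly smaller leading monomials ([term_sum_division]).
    Splitting into homogeneous components keeps all the terms of a combination
    in the degree of the polynomial that it represents, so that only
    S-polynomials of degree at most [d] occur.

    Let [r] be the remainder of [p].  It is nonzero because [p] is outside the
    ideal, homogeneous of degree [d], and no leading monomial of [G] divides its
    leading monomial.  Since [p - r] is in the ideal of [G], adjoining [r] or [p]
    generates the same ideal.  Three kinds of S-polynomials remain.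
    - That of [r] with itself is zero.
    - For [g] in [G], the least common multiple of the leading monomials of [g]
      and [r] is a proper multiple of the one of [r], hence has degree larger
      than [d]; this is the degree of the S-polynomial, unless it vanishes.
    - For two elements of [G] an S-polynomial of degree at most [d] is in the
      ideal of [G], but it must now be divided by an enlarged list, in an order
      unrelated to the previous one.  By degree reasons the leading monomial of
      [r] could only divide that of a dividend by being equal to it, which the
      truncated criterion excludes; so the division uses only elements of [G],
      stays in the ideal, and by the criterion never stops before reaching zero
      ([mrem_genideal]). *)

(** * Ideals *)

Section Ideals.
Variables (K : fieldType) (n : nat).
Local Notation R := {mpoly K[n]}.
Implicit Types (f g q : R) (A B : {fset R}).

Lemma genideal0 A : genideal A 0.
Proof. by exists (fun=> 0); rewrite big1 // => g _; rewrite mul0r. Qed.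

Lemma genideal_mem A g : g \in A -> genideal A g.
Proof.
move=> gA; exists (fun h => (h == g)%:R).
rewrite (big_fsetD1 g) //= eqxx mul1r big_seq big1 ?addr0 // => h.
by rewrite in_fsetD1 => /andP[/negPf -> _]; rewrite mul0r.
Qed.

Lemma genidealD A f1 f2 : genideal A f1 -> genideal A f2 -> genideal A (f1 + f2).
Proof.
move=> [c1 ->] [c2 ->]; exists (fun g => c1 g + c2 g).
by rewrite -big_split /=; apply: eq_bigr => g _; rewrite mulrDl.
Qed.

Lemma genidealM A q f : genideal A f -> genideal A (q * f).
Proof.
case=> c ->; exists (fun g => q * c g).
by rewrite mulr_sumr; apply: eq_bigr => g _; rewrite mulrA.
Qed.

Lemma genidealB A f1 f2 : genideal A f1 -> genideal A f2 -> genideal A (f1 - f2).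
Proof. by move=> h1 /(genidealM (-1)); rewrite mulN1r; apply: genidealD. Qed.

Lemma genideal_le A B f :
  (forall g, g \in A -> genideal B g) -> genideal A f -> genideal B f.
Proof.
move=> hA [c ->]; rewrite big_seq; apply: (big_ind (genideal B)) => [||g gA].
- exact: genideal0.
- exact: genidealD.
exact/genidealM/hA.
Qed.

Lemma genideal_subset A B f :
  (A `<=` B)%fset -> genideal A f -> genideal B f.
Proof. by move/fsubsetP=> AB; apply: genideal_le => g /AB/genideal_mem. Qed.

End Ideals.

Section Groebner.
Variables (K : fieldType) (n : nat) (ord : monomial_order n).
Local Notation R := {mpoly K[n]}.
Local Notation lm := (lm ord).
Local Notation lc := (lc ord).
Local Notation mrem := (mrem ord).
Local Notation Spoly := (Spoly ord).
Local Notation sord := (fun m1 m2 => ord m1 m2 && (m1 != m2)).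
Implicit Types (p q f g h : R) (gs : seq R) (A G : {fset R}).
Implicit Types (m a b : 'X_{1..n}) (P : 'X_{1..n} -> Prop).

(** * Leading monomials *)

Lemma lem_mdeg_eq m1 m2 :
  (m1 <= m2)%MM -> (mdeg m2 <= mdeg m1)%N -> m2 = m1.
Proof.
move=> le; rewrite -{1 2}(submK le) mdegD -[X in (_ <= X)%N]add0n leq_add2r.
by rewrite leqn0 mdeg_eq0 => /eqP->; rewrite add0m.
Qed.

Lemma sordD b m1 m2 : sord m1 m2 -> sord (b + m1)%MM (b + m2)%MM.
Proof.
case/andP=> le ne; rewrite mo_mul //=; apply: contraNneq ne => e.
by rewrite -(addmK b m1) -(addmK b m2) /= ![(_ + b)%MM]addmC e.
Qed.

Lemma le_sord m1 m2 m3 : ord m1 m2 -> sord m2 m3 -> sord m1 m3.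
Proof.
move=> le12 /andP[le23 ne]; rewrite (mo_trans le12 le23) /=.
apply: contraNneq ne => e; rewrite -e in le23 *.
by apply/eqP/(@mo_anti _ ord); rewrite le12 le23.
Qed.

Lemma lm_eq p m : p@_m != 0 -> {in msupp p, forall m', ord m' m} -> lm p = m.
Proof.
move=> pm hm; have mp : m \in msupp p by rewrite mcoeff_msupp.
have p0 : p != 0 by apply: contraNneq pm => ->; rewrite mcoeff0.
by apply: (@mo_anti _ ord); rewrite hm ?lm_in // lm_max.
Qed.

Lemma mdeg_lm p e : p != 0 -> p \is e.-homog -> mdeg (lm p) = e.
Proof. by move=> p0 /dhomogP; apply; apply: lm_in. Qed.

Lemma tdegE p e : p != 0 -> p \is e.-homog -> tdeg p = e.
Proof.
move=> p0 hp; have := dhomog_uniq p0 hp (dhomog_msize hp).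
by rewrite /tdeg /= => ->.
Qed.

Lemma mcoeff_term c a g : (c *: 'X_[a] * g)@_(a + lm g) = c * lc g.
Proof. by rewrite -scalerAl (mulrC 'X_[_]) mcoeffZ mcoeffMX. Qed.

Lemma msupp_term c a g :
  {in msupp (c *: 'X_[a] * g), forall m, ord m (a + lm g)%MM}.
Proof.
move=> m; rewrite -scalerAl => /msuppZ_le.
rewrite (mulrC 'X_[_]) (perm_mem (msuppMX _ _)) => /mapP[m' /lm_max hm' ->].
exact: mo_mul.
Qed.

Lemma lm_term c a g : c != 0 -> g != 0 -> lm (c *: 'X_[a] * g) = (a + lm g)%MM.
Proof.
move=> c0 g0; apply: lm_eq; last exact: msupp_term.
by rewrite mcoeff_term mulf_neq0 // lc_neq0.
Qed.

Lemma homog_term c a g e : g != 0 -> g \is e.-homog ->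
  c *: 'X_[a] * g \is (mdeg (a + lm g)).-homog.
Proof.
move=> g0 hg; rewrite -scalerAl mdegD (mdeg_lm g0 hg).
by apply/dhomogZ/dhomogM => //; rewrite dhomogX.
Qed.

(** * Sums of monomial multiples of the generators *)

(** The predicate [P] restricts the leading monomials of the summands before
    cancellation.  Taking [P] to be a bound and a degree, it expresses the
    standard representations [sum c_i x^(a_i) g_i] of the theory. *)
Inductive term_sum A P : R -> Prop :=
| TermSum0 : term_sum A P 0
| TermSumD c a g f of g \in A & P (a + lm g)%MM & term_sum A P f :
    term_sum A P (c *: 'X_[a] * g + f).

Lemma term_sum1 A P c a g :
  g \in A -> P (a + lm g)%MM -> term_sum A P (c *: 'X_[a] * g).
Proof. by move=> gA Pg; rewrite -[_ * g]addr0; do 2?constructor. Qed.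

Lemma term_sumD A P f1 f2 :
  term_sum A P f1 -> term_sum A P f2 -> term_sum A P (f1 + f2).
Proof.
move=> s1 s2; elim: s1 => [|c a g f gA Pg _ IH]; first by rewrite add0r.
by rewrite -addrA; constructor.
Qed.

Lemma term_sum_mul A P P' c b f : (forall m, P m -> P' (b + m)%MM) ->
  term_sum A P f -> term_sum A P' (c *: 'X_[b] * f).
Proof.
move=> PP'; elim=> [|c' a g f' gA Pg _ IH]; first by rewrite mulr0; constructor.
rewrite mulrDr mulrA -scalerAl -scalerAr scalerA -mpolyXD.
by constructor=> //; rewrite -addmA; apply: PP'.
Qed.

Lemma term_sum_sub A P P' f :
  (forall m, P m -> P' m) -> term_sum A P f -> term_sum A P' f.
Proof.
by move=> PP'; elim=> [|c a g f' gA /PP' Pg _ IH]; constructor.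
Qed.

(** A finite sum has a largest leading monomial, because the order is total; this
    is what allows well-founded induction on the bound of a representation. *)
Lemma term_sum_max A P f : term_sum A P f ->
  f = 0 \/ exists2 m, P m & term_sum A (fun m' => P m' /\ ord m' m) f.
Proof.
elim=> [|c a g f' gA Pg _ IH]; [by left|right].
set m := (a + lm g)%MM in Pg *.
case: IH => [->|[m' Pm' s]].
  exists m => //; rewrite addr0; apply: term_sum1 => //.
  by split=> //; apply: mo_refl.
have /orP[le|le] := mo_total ord m m'.
  exists m' => //; constructor=> //.
exists m => //; constructor=> //; first by split=> //; apply: mo_refl.
by apply: term_sum_sub s => m'' [? /mo_trans h]; split=> //; apply: h.
Qed.

Lemma term_sum_genideal A f : term_sum A (fun=> True) f <-> genideal A f.
Proof.
split=> [|[c ->]].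
  elim=> [|c a g f' gA _ _]; first exact: genideal0.
  exact/genidealD/genidealM/genideal_mem.
rewrite big_seq; apply: (big_ind (term_sum A (fun=> True))) => [||g gA].
- by constructor.
- exact: term_sumD.
rewrite [c g]mpolyE mulr_suml.
apply: (big_ind (term_sum A (fun=> True))) => [||m _].
- by constructor.
- exact: term_sumD.
exact: term_sum1.
Qed.

(** With homogeneous generators each summand is homogeneous, so taking a
    component of degree [e] keeps a summand unchanged or erases it. *)
Lemma term_sum_pihomog A P e f :
    (forall g, g \in A -> g != 0 /\ exists k, g \is k.-homog) ->
  term_sum A P f ->
  term_sum A (fun m => P m /\ mdeg m = e) (pihomog mdeg e f).
Proof.
move=> hA; elim=> [|c a g f' gA Pg _ IH]; first by rewrite pihomog0; constructor.
have [g0 [k hg]] := hA g gA; have ht := homog_term c a g0 hg.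
rewrite pihomogD; have [de|de] := eqVneq (mdeg (a + lm g)) e.
  by rewrite pihomog_dE -?de //; constructor=> //; rewrite de.
by rewrite (pihomog_ne0 de ht) add0r.
Qed.

Lemma term_sum_homog A P e f :
    (forall g, g \in A -> g != 0 /\ exists k, g \is k.-homog) ->
    f \is e.-homog -> term_sum A P f ->
  term_sum A (fun m => P m /\ mdeg m = e) f.
Proof. by move=> hA hf /(term_sum_pihomog e hA); rewrite pihomog_dE. Qed.

Lemma msupp_term_sum A m f : term_sum A (fun m' => sord m' m) f ->
  {in msupp f, forall m', sord m' m}.
Proof.
elim=> [|c a g f' gA lt _ IH] m'; first by rewrite msupp0.
by move/msuppD_le; rewrite mem_cat => /orP[/msupp_term h|/IH //];
   apply: le_sord h lt.
Qed.

Lemma genideal_Spoly A g h : g \in A -> h \in A -> genideal A (Spoly g h).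
Proof. by move=> gA hA; apply: genidealB; apply/genidealM/genideal_mem. Qed.

(** * The division algorithm *)

(** Induction along the division algorithm, for a relation between a dividend
    and its remainder. *)
Lemma division_ind gs (Q : R -> R -> Prop) :
    Q 0 0 ->
    (forall p g r, p != 0 -> g \in gs -> g != 0 -> (lm g <= lm p)%MM ->
      let p' := p - (lc p / lc g) *: 'X_[lm p - lm g] * g in
      div_lt ord p' p -> Q p' r -> Q p r) ->
    (forall p r, p != 0 ->
      (forall g, g \in gs -> g != 0 -> ~~ (lm g <= lm p)%MM) ->
      div_lt ord (p - lt ord p) p ->
      Q (p - lt ord p) r -> Q p (lt ord p + r)) ->
  forall p, Q p (mrem p gs).
Proof.
move=> Q0 Qstep Qout; apply: (well_founded_ind (div_lt_wf ord)) => p IH.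
rewrite mrem_unfold; have [->|p0] := eqVneq p 0; first exact: Q0.
have lt := div_next_lt ord gs (elimN eqP p0); have := IH _ lt; move: lt.
rewrite /div_next /div_out /divisor; case E: (ohead _) => [g|].
  have: g \in [seq g <- gs | (g != 0) && (lm g <= lm p)%MM].
    by case: [seq _ <- _ | _] E => //= ? ? [->]; apply: mem_head.
  rewrite mem_filter add0r => /andP[/andP[g0 dvd] ggs] lt.
  exact: Qstep.
move=> lt; apply: Qout => // g ggs g0; apply/negP=> dvd.
have: g \in [seq g <- gs | (g != 0) && (lm g <= lm p)%MM].
  by rewrite mem_filter g0 dvd.
by case: [seq _ <- _ | _] E.
Qed.

Lemma mrem0 gs : mrem 0 gs = 0.
Proof. by rewrite mrem_unfold eqxx. Qed.

(** The quotients found by the division algorithm form a standard representation,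
    since the leading monomials of the successive dividends decrease. *)
Lemma term_sum_division A gs p : {subset gs <= A} -> p != 0 ->
  term_sum A (fun m => ord m (lm p)) (p - mrem p gs).
Proof.
move=> sub p0.
(* Generalizing the bound makes the induction pass; the zero dividend is treated
   apart because its leading monomial is a default value. *)
suff H : forall m, p = 0 \/ ord (lm p) m ->
    term_sum A (fun m' => ord m' m) (p - mrem p gs).
  by apply: H; right; apply: mo_refl.
have lower q q' m : div_lt ord q' q -> q = 0 \/ ord (lm q) m ->
    q' = 0 \/ ord (lm q') m.
  case=> q0 [->|/andP[le _]]; [by left|case=> [e|/(mo_trans le)]; last by right].
  by rewrite e eqxx in q0.
elim/(@division_ind gs): p / {p0}(mrem _ _).
- by move=> m _; rewrite subrr; constructor.
- move=> q g r q0 ggs g0 dvd q' lt IH m hm.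
  have -> : q - r = (lc q / lc g) *: 'X_[lm q - lm g] * g + (q' - r).
    by rewrite addrA (addrC _ q') subrK.
  constructor; first exact: sub.
    by rewrite submK //; case: hm q0 => [->|//]; rewrite eqxx.
  exact/IH/(lower q).
move=> q r q0 _ lt IH m hm; rewrite opprD addrA.
exact/IH/(lower q).
Qed.

Lemma genideal_division A gs p : {subset gs <= A} -> genideal A (p - mrem p gs).
Proof.
move=> sub; apply/term_sum_genideal; have [->|p0] := eqVneq p 0.
  by rewrite mrem0 subrr; constructor.
exact: term_sum_sub (term_sum_division sub p0).
Qed.

Lemma homog_reduction p g d e : p != 0 -> g != 0 -> (lm g <= lm p)%MM ->
    p \is d.-homog -> g \is e.-homog ->
  p - (lc p / lc g) *: 'X_[lm p - lm g] * g \is d.-homog.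
Proof.
move=> p0 g0 dvd hp hg; apply: rpredB => //.
have := homog_term (lc p / lc g) (lm p - lm g) g0 hg.
by rewrite submK // (mdeg_lm p0 hp).
Qed.

Lemma homog_mrem gs p d : {in gs, forall g, exists e, g \is e.-homog} ->
  p \is d.-homog -> mrem p gs \is d.-homog.
Proof.
move=> hgs; elim/(@division_ind gs): p / (mrem _ _) => //.
  move=> p g r p0 ggs g0 dvd p' _ IH hp; apply: IH.
  by have [e] := hgs g ggs; apply: homog_reduction.
move=> p r p0 _ _ IH hp.
have hlt : lt ord p \is d.-homog.
  by apply: dhomogZ; rewrite dhomogX; apply/eqP/mdeg_lm.
by apply: rpredD => //; apply: IH; apply: rpredB.
Qed.

Lemma mrem_reduced gs p g m :
  g \in gs -> g != 0 -> m \in msupp (mrem p gs) -> ~~ (lm g <= m)%MM.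
Proof.
move=> ggs g0; elim/(@division_ind gs): p / (mrem _ _) => //.
  by rewrite msupp0.
move=> p r _ hout _ IH /msuppD_le; rewrite mem_cat => /orP[|//].
move/msuppZ_le; rewrite msuppX inE => /eqP ->; exact: hout.
Qed.

(** * S-polynomials *)

(** The degree is that of the least common multiple even though its monomial
    cancels, because both multiples are homogeneous of this degree. *)
Lemma homog_Spoly g h e1 e2 : g != 0 -> h != 0 -> g \is e1.-homog ->
  h \is e2.-homog -> Spoly g h \is (mdeg (mlcm (lm g) (lm h))).-homog.
Proof.
move=> g0 h0 hg hh; rewrite /Spoly; set L := mlcm _ _.
have := homog_term (lc g)^-1 (L - lm g) g0 hg.
have := homog_term (lc h)^-1 (L - lm h) h0 hh.
rewrite !submK ?lem_mlcml ?lem_mlcmr // => h1 h2; exact: rpredB.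
Qed.

(** The two normalized multiples have coefficient 1 at the least common multiple,
    and no larger monomial. *)
Lemma lm_Spoly g h : g != 0 -> h != 0 -> Spoly g h != 0 ->
  sord (lm (Spoly g h)) (mlcm (lm g) (lm h)).
Proof.
move=> g0 h0; rewrite /Spoly; set L := mlcm _ _.
set u := _ * g; set v := _ * h => uv0.
have gL : (L - lm g + lm g)%MM = L by rewrite submK ?lem_mlcml.
have hL : (L - lm h + lm h)%MM = L by rewrite submK ?lem_mlcmr.
have ug : u@_L = 1 by rewrite -{1}gL mcoeff_term mulVf ?lc_neq0.
have vh : v@_L = 1 by rewrite -{1}hL mcoeff_term mulVf ?lc_neq0.
have lu : lm u = L by rewrite lm_term ?invr_eq0 ?lc_neq0.
have u0 : u != 0 by apply: contra_eq_neq ug => ->; rewrite mcoeff0 eq_sym oner_eq0.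
have: div_lt ord (u - v) u.
  apply: div_lt_sub; rewrite ?/Defs.lc ?lu ?ug ?vh // => m.
  by move/msupp_term; rewrite hL.
by rewrite /div_lt lu => -[_ [/eqP|//]]; rewrite (negPf uv0).
Qed.

Lemma SpolyC g h : Spoly h g = - Spoly g h.
Proof. by rewrite /Spoly opprB mlcmC. Qed.

Lemma Spolyxx g : Spoly g g = 0.
Proof. by rewrite /Spoly subrr. Qed.

(** * The criterion of Buchberger in bounded degree *)

Section Criterion.
Variables (G : {fset R}) (gs : seq R) (d : nat).
Hypothesis G_homog : forall g, g \in G -> g != 0 /\ exists e, g \is e.-homog.
Hypothesis gsG : {subset gs <= G}.
Hypothesis G_Spoly : forall g h, g \in G -> h \in G ->
  mrem (Spoly g h) gs = 0 \/ (d < tdeg (Spoly g h))%N.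

Let below e m m' := sord m' m /\ mdeg m' = e.

(** The difference is [x^(m - L)] times the S-polynomial of [g] and [h], where [L]
    is the least common multiple of their leading monomials.  If nonzero, this
    S-polynomial has degree [mdeg L <= d], so its remainder is zero and the
    division by [gs] represents it below [L]. *)
Lemma critical_pair g h a b m : g \in G -> h \in G ->
    (a + lm g)%MM = m -> (b + lm h)%MM = m -> (mdeg m <= d)%N ->
  term_sum G (below (mdeg m) m)
    ((lc g)^-1 *: 'X_[a] * g - (lc h)^-1 *: 'X_[b] * h).
Proof.
move=> gG hG ga hb md; have [g0 [e1 hg]] := G_homog gG.
have [h0 [e2 hh]] := G_homog hG.
set L := mlcm (lm g) (lm h).
have Lm : (L <= m)%MM by rewrite lem_mlcm -{1}ga -hb !lem_addl.
have aE : a = (m - L + (L - lm g))%MM.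
  by rewrite addmBA ?lem_mlcml // submK // -ga addmK.
have bE : b = (m - L + (L - lm h))%MM.
  by rewrite addmBA ?lem_mlcmr // submK // -hb addmK.
have -> : (lc g)^-1 *: 'X_[a] * g - (lc h)^-1 *: 'X_[b] * h =
          1 *: 'X_[m - L] * Spoly g h.
  rewrite scale1r /Spoly -/L mulrBr aE bE !mpolyXD.
  by rewrite -!scalerAl -!scalerAr -!mulrA.
have [->|S0] := eqVneq (Spoly g h) 0; first by rewrite mulr0; constructor.
have hS := homog_Spoly g0 h0 hg hh; rewrite -/L in hS.
have LS := lm_Spoly g0 h0 S0; rewrite -/L in LS.
have degL : (mdeg L <= mdeg m)%N by rewrite -(submK Lm) mdegD leq_addl.
have S_rem : mrem (Spoly g h) gs = 0.
  case: (G_Spoly gG hG) => //.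
  by rewrite (tdegE S0 hS) ltnNge (leq_trans degL md).
have := term_sum_division gsG S0; rewrite S_rem subr0.
move/(term_sum_homog G_homog hS); apply: term_sum_mul => m' [le de]; split.
  by have := sordD (m - L)%MM (le_sord le LS); rewrite submK.
by rewrite mdegD de -mdegD submK.
Qed.

(** By [critical_pair] the summands with leading monomial [m] are proportional up
    to summands strictly below [m], hence can be merged into at most one. *)
Lemma top_term e m f : (e <= d)%N ->
    term_sum G (fun m' => mdeg m' = e /\ ord m' m) f ->
  term_sum G (below e m) f \/
  exists c a g v, [/\ g \in G, (a + lm g)%MM = m, c != 0,
    term_sum G (below e m) v & f = c *: 'X_[a] * g + v].
Proof.
move=> ed; elim=> [|c a g f' gG [de le] _ IH]; first by left; constructor.
have [gm|gm] := eqVneq (a + lm g)%MM m; last first.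
  have gb : below e m (a + lm g)%MM by rewrite /below le gm.
  case: IH => [s|[c' [a' [g' [v [gG' gm' c0 s ->]]]]]]; [left|right].
    by constructor.
  by exists c', a', g', (c *: 'X_[a] * g + v); split=> //;
     [constructor|rewrite addrCA].
have [->|c0] := eqVneq c 0; first by rewrite scale0r mul0r add0r.
case: IH => [s|[c' [a' [g' [v [gG' gm' c'0 s ->]]]]]].
  by right; exists c, a, g, f'.
(* Two summands at [m]: replace [x^a g] by the multiple of [x^a' g'] with the same
   leading term; [D] is the resulting correction, below [m]. *)
have [g0 _] := G_homog gG.
have := critical_pair gG gG' gm gm'.
rewrite -gm de gm => /(_ ed) /(@term_sum_mul _ _ (below e m) (c * lc g) 0%MM).
rewrite mpolyX0 => cp; have {}cp := cp (fun m' => ltac:(by rewrite add0m)).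
set D := _ * _ in cp; have sv := term_sumD cp s.
set k := c * lc g / lc g' + c'.
have -> : c *: 'X_[a] * g + (c' *: 'X_[a'] * g' + v) =
          k *: 'X_[a'] * g' + (D + v).
  rewrite /D /k -!scalerAl mul1r scalerBr !scalerA mulfK ?lc_neq0 //.
  by rewrite scalerDl [RHS]addrACA [in RHS](addrC (_ *: _)) subrK.
have [->|k0] := eqVneq k 0; first by rewrite scale0r mul0r add0r; left.
by right; exists k, a', g', (D + v).
Qed.

(** If a single summand with leading monomial [m] remains, its leading term cannot
    cancel and [lm f = m]; otherwise the bound [m] can be lowered. *)
Lemma lm_dvd_of_term_sum e m f : (e <= d)%N -> f != 0 ->
    term_sum G (fun m' => mdeg m' = e /\ ord m' m) f ->
  exists2 g, g \in G & (lm g <= lm f)%MM.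
Proof.
move=> ed f0; elim/(well_founded_ind (mo_wf ord)): m => m IH.
case/(top_term ed) => [s|[c [a [g [v [gG gm c0 s fE]]]]]].
  case: (term_sum_max s) f0 => [->|[m' [lt _] s'] _]; first by rewrite eqxx.
  apply: (IH _ lt); apply: term_sum_sub s' => m'' [[_ ?] ?]; by split.
have [g0 _] := G_homog gG; exists g => //.
have vlt : {in msupp v, forall m', sord m' m}.
  by apply: msupp_term_sum (term_sum_sub _ s) => m' [].
have -> : lm f = m.
  apply: lm_eq => [|m']; rewrite fE.
    rewrite mcoeffD -{1}gm mcoeff_term [v@_m]memN_msupp_eq0 ?addr0.
      by rewrite mulf_neq0 ?lc_neq0.
    by apply/negP=> /vlt; rewrite eqxx andbF.
  move/msuppD_le; rewrite mem_cat => /orP[/msupp_term|/vlt /andP[//]].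
  by rewrite gm.
by rewrite -gm lem_addl.
Qed.

(** Buchberger's criterion in degrees at most [d]. *)
Lemma lm_dvd_of_genideal e f : (e <= d)%N -> f \is e.-homog -> f != 0 ->
  genideal G f -> exists2 g, g \in G & (lm g <= lm f)%MM.
Proof.
move=> ed hf f0 /term_sum_genideal /(term_sum_homog G_homog hf) s.
case: (term_sum_max s) f0 => [->|[m _ s'] f0]; first by rewrite eqxx.
apply: (lm_dvd_of_term_sum ed f0 (m := m)).
by apply: term_sum_sub s' => m' [[_ ?] ?].
Qed.

(** The divisors [gs'] may contain, in any position, elements outside [G].  The two
    conditions on such an [h] forbid its use: it could only divide a leading
    monomial of degree [e] by being equal to it, while that monomial is divisible
    by a leading monomial of [G] and [lm h] is not.  So every dividend stays in
    the ideal of [G]. *)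
Lemma mrem_genideal gs' e f : (e <= d)%N -> {subset G <= gs'} ->
    (forall h m, h \in gs' -> h \notin G -> mdeg m = e ->
      (lm h <= m)%MM -> m = lm h) ->
    (forall h g, h \in gs' -> h \notin G -> g \in G -> ~~ (lm g <= lm h)%MM) ->
    f \is e.-homog -> genideal G f ->
  mrem f gs' = 0.
Proof.
move=> ed Ggs' extra red.
elim/(@division_ind gs'): f / (mrem _ _) => //.
  move=> f h r f0 hgs h0 dvd f' _ IH hf If.
  have hG : h \in G.
    apply/idPn => hG; have [g gG] := lm_dvd_of_genideal ed hf f0 If.
    rewrite (extra h (lm f)) ?(mdeg_lm f0 hf) //.
    exact/negP/red.
  have [_ [k hh]] := G_homog hG; apply: IH; first exact: homog_reduction hh.
  exact/genidealB/genidealM/genideal_mem.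
move=> f r f0 out _ _ hf If.
have [g gG dvd] := lm_dvd_of_genideal ed hf f0 If.
have [g0 _] := G_homog gG.
by have := out g (Ggs' g gG) g0; rewrite dvd.
Qed.

End Criterion.

End Groebner.

(** * Adjoining a remainder *)

Theorem theorem3 (K : fieldType) (n : nat) (ord : monomial_order n)
    (l : {fset {mpoly K[n]}} -> seq {mpoly K[n]}) (hl : is_listing l)
    (d : nat) (G : {fset {mpoly K[n]}})
    (hG : homog_groebner_upto ord l d G (genideal G))
    (p : {mpoly K[n]}) (hp : p \is d.-homog) (hpG : ~ genideal G p) :
  homog_groebner_upto ord l d (mrem ord p (l G) |` G)%fset
    (genideal (p |` G)%fset).
Proof.
case: hG => homG _ SG.
have lG A : l A =i A by have [] := hl A.
have subG : {subset l G <= G} by move=> g; rewrite lG.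
set r := mrem ord p (l G).
have pr : genideal G (p - r) by apply: genideal_division.
have r0 : r != 0 by apply/eqP=> e; move: pr; rewrite e subr0.
have hr : r \is d.-homog.
  by apply: homog_mrem => // g; rewrite lG => /homG[].
have red g : g \in G -> ~~ (lm ord g <= lm ord r)%MM.
  move=> gG; have [g0 _] := homG g gG.
  by apply: (@mrem_reduced _ _ ord (l G) p); rewrite ?lG // lm_in.
have homG' g : g \in (r |` G)%fset -> g != 0 /\ exists e, g \is e.-homog.
  by rewrite in_fset1U => /predU1P[->|/homG //]; split=> //; exists d.
have Sr g : g \in G -> Spoly ord g r != 0 -> (d < tdeg (Spoly ord g r))%N.
  move=> gG S0; have [g0 [e hg]] := homG g gG.
  rewrite (tdegE S0 (homog_Spoly ord g0 r0 hg hr)) ltnNge.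
  apply: contra (red g gG) => le.
  rewrite -(lem_mdeg_eq (lem_mlcmr (lm ord g) (lm ord r))) ?lem_mlcml //.
  by rewrite (mdeg_lm ord r0 hr).
split=> // [f|g h].
  split; apply: genideal_le => g; rewrite in_fset1U => /predU1P[->|gG].
  - rewrite -(subrK r p); apply: genidealD.
      by apply: genideal_subset pr; apply: fsubsetU1.
    by apply: genideal_mem; rewrite fset1U1.
  - by apply: genideal_mem; rewrite fset1Ur.
  - rewrite -[r](subKr p); apply: genidealB.
      by apply: genideal_mem; rewrite fset1U1.
    by apply: genideal_subset pr; apply: fsubsetU1.
  - by apply: genideal_mem; rewrite fset1Ur.
have [->|S0] := eqVneq (Spoly ord g h) 0; first by rewrite mrem0; left.
move: S0; rewrite !in_fset1U => S0 /predU1P[eg|gG] /predU1P[eh|hG].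
- by move: S0; rewrite eg eh Spolyxx eqxx.
- right; move: S0; rewrite eg SpolyC oppr_eq0 => /(Sr h hG).
  by rewrite /tdeg msizeN.
- by right; rewrite eh; apply: Sr => //; rewrite -eh.
have [|le] := ltnP d (tdeg (Spoly ord g h)); [by right|left].
have [[g0 [e1 hg]] [h0 [e2 hh]]] := (homG g gG, homG h hG).
have hS := homog_Spoly ord g0 h0 hg hh.
have dS := tdegE S0 hS; rewrite -dS in hS.
apply: (mrem_genideal homG subG SG le _ _ _ hS (genideal_Spoly ord gG hG)).
- by move=> k kG; rewrite lG fset1Ur.
- move=> k m; rewrite lG in_fset1U => /predU1P[->|-> //] _ dm dvd.
  by apply: lem_mdeg_eq => //; rewrite dm (mdeg_lm ord r0 hr).
- by move=> k k'; rewrite lG in_fset1U => /predU1P[->|-> //] _; apply: red.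
Qed.
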